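(* Let $G$ be a group with identity $e$, let $R$ be a $G$-graded commutative ring with nonzero unity, let $M$ be a $G$-graded unitary $R$-module, and let $\phi: GS(M)\rightarrow GS(M)\cup\{\emptyset\}$ be a function with $\phi(L)\subseteq L$ for all $L\in GS(M)$. Let $g\in G$ and let $K$ be a $g$-$\phi$-prime $R$-submodule of $M$. If $(K:_{R_e}M)K_g\nsubseteq\phi(K)$, then $K$ is a $g$-prime $R$-submodule of $M$.
   Context: $G$ is a group with identity $e$. $R=\bigoplus_{h\in G}R_h$ is a $G$-graded commutative ring with nonzero unity $1$ ($R_h$ additive subgroups, $R_hR_k\subseteq R_{hk}$), and $M=\bigoplus_{h\in G}M_h$ is a $G$-graded unitary $R$-module ($M_h$ additive subgroups, $R_hM_k\subseteq M_{hk}$). An $R$-submodule $K$ of $M$ is graded if $K=\bigoplus_{h\in G}(K\cap M_h)$; write $K_h=K\cap M_h$. $GS(M)$ is the set of all graded $R$-submodules of $M$. Notation: $(K:_RM)=\{r\in R: rM\subseteq K\}$ and $(K:_{R_e}M)=\{r\in R_e: rM\subseteq K\}$. $(K:_{R_e}M)K_g$ denotes the additive subgroup generated by the products $st$ with $s\in(K:_{R_e}M)$, $t\in K_g$. $K-\phi(K)$ denotes set difference. Let $g\in G$ and let $K$ be a graded $R$-submodule of $M$ with $K_g\neq M_g$. - $K$ is a $g$-$\phi$-prime $R$-submodule of $M$ if whenever $r\in R_e$ and $m\in M_g$ satisfy $rm\in K-\phi(K)$, then $m\in K$ or $r\in(K:_RM)$. - $K$ is a $g$-prime $R$-submodule of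 $M$ if whenever $r\in R_e$ and $m\in M_g$ satisfy $rm\in K$, then $m\in K$ or $r\in(K:_RM)$. *)

(* Defs.v *)
From mathcomp Require Import all_boot all_algebra.
From mathcomp Require Import boolp classical_sets functions cardinality fsbigop.

Set Implicit Arguments.
Unset Strict Implicit.
Unset Printing Implicit Defensive.
Import GRing.Theory.
Local Open Scope classical_set_scope.
Local Open Scope ring_scope.

(* [\sum_(h \in setT) f h] is [0] by convention when [f] has infinite support,
   hence the explicit finiteness requirement. *)
Definition decomposition (G : choiceType) (V : zmodType) (A : G -> set V)
    (x : V) (f : G -> V) : Prop :=
  [/\ finite_set [set h | f h != 0], (forall h, A h (f h))
    & x = \sum_(h \in [set: G]) f h].

Definition internal_direct_sum (G : choiceType) (V : zmodType)
    (W : set V) (A : G -> set V) : Prop :=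
  [/\ forall h, zmod_closed (mem (A h)),
      W = [set x | exists f, decomposition A x f]
    & forall x f1 f2,
        decomposition A x f1 -> decomposition A x f2 -> f1 =1 f2].

Definition graded_ring (G : groupType) (R : comNzRingType) (Rg : G -> set R) :
    Prop :=
  internal_direct_sum [set: R] Rg /\
  forall h k r s, Rg h r -> Rg k s -> Rg (h * k)%g (r * s).

Definition graded_module (G : groupType) (R : comNzRingType) (Rg : G -> set R)
    (M : lmodType R) (Mg : G -> set M) : Prop :=
  internal_direct_sum [set: M] Mg /\
  forall h k r m, Rg h r -> Mg k m -> Mg (h * k)%g (r *: m).

Record graded_submodule (G : groupType) (R : comNzRingType) (M : lmodType R)
    (Mg : G -> set M) := GradedSubmodule {
  gsub_set :> set M;
  gsub_submod : submod_closed (mem gsub_set);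
  gsub_graded : internal_direct_sum gsub_set (fun h => gsub_set `&` Mg h) }.

(* Functions into GS(M) \cup {emptyset} are option-valued, with [None]
   standing for the empty set. *)
Definition set_of_option (G : groupType) (R : comNzRingType) (M : lmodType R)
    (Mg : G -> set M) (L : option (graded_submodule Mg)) : set M :=
  if L is Some L' then L' : set M else set0.

Definition colon (R : comNzRingType) (M : lmodType R) (K : set M) : set R :=
  [set r | forall m, K (r *: m)].

Definition colon_in (R : comNzRingType) (M : lmodType R) (S : set R)
    (K : set M) : set R :=
  [set r | S r /\ forall m, K (r *: m)].

Definition prod_subgroup (R : comNzRingType) (M : lmodType R)
    (S : set R) (T : set M) : set M :=
  smallest (fun A : set M => zmod_closed (mem A))
    [set s *: t | s in S & t in T].

Definition g_phi_prime (G : groupType) (R : comNzRingType) (Rg : G -> set R)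
    (M : lmodType R) (Mg : G -> set M)
    (phi : graded_submodule Mg -> option (graded_submodule Mg)) (g : G)
    (K : graded_submodule Mg) : Prop :=
  K `&` Mg g <> Mg g /\
  forall r m, Rg 1%g r -> Mg g m -> (K `\` set_of_option (phi K)) (r *: m) ->
    gsub_set K m \/ colon K r.

Definition g_prime (G : groupType) (R : comNzRingType) (Rg : G -> set R)
    (M : lmodType R) (Mg : G -> set M) (g : G) (K : graded_submodule Mg) :
    Prop :=
  K `&` Mg g <> Mg g /\
  forall r m, Rg 1%g r -> Mg g m -> gsub_set K (r *: m) ->
    gsub_set K m \/ colon K r.

(* Main.v *)
Require Import Defs.
From mathcomp Require Import all_boot all_algebra.
From mathcomp Require Import boolp classical_sets functions cardinality fsbigop.
Set Implicit Arguments.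
Unset Strict Implicit.
Unset Printing Implicit Defensive.
Import GRing.Theory.
Local Open Scope classical_set_scope.
Local Open Scope ring_scope.

(** Write [S] for the degree-[e] part of the colon ideal of [K] and suppose that
    [r] in [R_e] and [m] in [M_g] satisfy [r m] in [K].  If [r m] lies outside
    [phi K], the definition of a [g]-[phi]-prime submodule applies directly, so
    the only issue is [r m] in [phi K]; in particular [phi K] is then a genuine
    submodule.  Replacing [r] by [r + s] with [s] in [S], and [m] by [m + k]
    with [k] in [K_g], changes neither whether the product lies in [K] nor the
    desired conclusion ([r] in the colon ideal, or [m] in [K]).  It is therefore
    enough to find [s] and [k] with [(r + s) (m + k)] outside [phi K].

    As the group generated by [S K_g] is not inside the subgroup [phi K], some
    product [s k] is outside it ([prod_subgroup_subPn]).  In the expansion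
    [(r + s) (m + k) = r m + r k + s m + s k] the term [r m] is in [phi K].  If
    [r k] is not, then [r (m + k)] works; if [s m] is not, then [(r + s) m]
    works; and if both are, then [s k] is the only term outside [phi K] and
    [(r + s) (m + k)] works ([perturb_out_of_subgroup]). *)

Section Subgroups.
Context (V : zmodType) (A : set V) (hA : zmod_closed (mem A)).

Lemma subgroup0 : A 0.
Proof. by case: hA => /set_mem. Qed.

Lemma subgroupB (x y : V) : A x -> A y -> A (x - y).
Proof. by case: hA => _ hB /mem_set Ax /mem_set Ay; apply/set_mem/hB. Qed.

Lemma subgroupD (x y : V) : A x -> A y -> A (x + y).
Proof.
move=> Ax Ay; rewrite -[y]opprK; apply: subgroupB => //.
by rewrite -sub0r; apply: subgroupB => //; exact: subgroup0.
Qed.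

Lemma subgroupDl (x y : V) : A x -> A (x + y) <-> A y.
Proof.
move=> Ax; split; last exact: subgroupD.
by move=> Axy; have := subgroupB Axy Ax; rewrite addrAC subrr add0r.
Qed.

Lemma subgroupDr (x y : V) : A y -> A (x + y) <-> A x.
Proof. by rewrite addrC; exact: subgroupDl. Qed.

End Subgroups.

Section Products.
Context (R : comNzRingType) (M : lmodType R).

Lemma prod_subgroup_subPn (S : set R) (T A : set M) :
  zmod_closed (mem A) -> ~ (prod_subgroup S T `<=` A) ->
  exists s t, [/\ S s, T t & ~ A (s *: t)].
Proof.
move=> hA hST; apply: contrapT => noST; apply: hST.
apply: smallest_sub => // _ [s Ss [t Tt <-]].
by apply: contrapT => nAst; apply: noST; exists s, t.
Qed.

(** The zero increments allowed in the conclusion let one statement cover all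
    three perturbations [r (m + k)], [(r + s) m] and [(r + s) (m + k)]. *)
Lemma perturb_out_of_subgroup (A : set M) (r s : R) (m k : M) :
  zmod_closed (mem A) -> A (r *: m) -> ~ A (s *: k) ->
  exists s' k', [/\ s' = 0 \/ s' = s, k' = 0 \/ k' = k
                  & ~ A ((r + s') *: (m + k'))].
Proof.
move=> hA Arm nAsk.
have [Ark|nArk] := pselect (A (r *: k)); last first.
  exists 0, k; split; [by left | by right |].
  by rewrite addr0 scalerDr (subgroupDl hA _ Arm).
have [Asm|nAsm] := pselect (A (s *: m)); last first.
  exists s, 0; split; [by right | by left |].
  by rewrite addr0 scalerDl (subgroupDl hA _ Arm).
exists s, k; split; [by right | by right |].
rewrite scalerDl !scalerDr (subgroupDl hA); last exact: subgroupD.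
by rewrite (subgroupDl hA).
Qed.

End Products.

Section GradedSubmodules.
Context (G : groupType) (R : comNzRingType) (M : lmodType R) (Mg : G -> set M).
Implicit Type L : graded_submodule Mg.

Lemma gsub_zmod_closed L : zmod_closed (mem (gsub_set L)).
Proof. exact: GRing.submod_closedB (gsub_submod L). Qed.

Lemma gsub_scale L (a : R) (x : M) : gsub_set L x -> gsub_set L (a *: x).
Proof.
case: (gsub_submod L) => L0 hL /mem_set Lx.
by have := hL a x 0 Lx L0; rewrite addr0 => /set_mem.
Qed.

End GradedSubmodules.

Theorem theorem2p3 (G : groupType) (R : comNzRingType) (Rg : G -> set R)
    (hR : graded_ring Rg) (M : lmodType R) (Mg : G -> set M)
    (hM : graded_module Rg Mg)
    (phi : graded_submodule Mg -> option (graded_submodule Mg))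
    (hphi : forall L : graded_submodule Mg, set_of_option (phi L) `<=` L)
    (g : G) (K : graded_submodule Mg) (hK : g_phi_prime Rg phi g K)
    (hKphi : ~ (prod_subgroup (colon_in (Rg 1%g) K) (K `&` Mg g)
                  `<=` set_of_option (phi K))) :
  g_prime Rg g K.
Proof.
have hRe : zmod_closed (mem (Rg 1%g)) by case: hR => -[].
have hMg : zmod_closed (mem (Mg g)) by case: hM => -[].
have hKz := gsub_zmod_closed K.
case: hK => KgN hK; split=> // r m Rr Mm Krm.
have [phirm|nphirm] := pselect (set_of_option (phi K) (r *: m)); last exact: hK.
have hphiK : zmod_closed (mem (set_of_option (phi K))).
  by case: (phi K) phirm => //= L _; exact: gsub_zmod_closed.
have [s [k [[Rs Ks] [Kk Mk] nsk]]] := prod_subgroup_subPn hphiK hKphi.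
have [s' [k' [s'E k'E out]]] :=
  perturb_out_of_subgroup hphiK phirm nsk.
have [Rs' Ks'] : colon_in (Rg 1%g) K s'.
  case: s'E => -> //; split=> [|x]; first exact: subgroup0.
  by rewrite scale0r; exact: subgroup0.
have [Kk' Mk'] : (K `&` Mg g) k'.
  by case: k'E => -> //; split; exact: subgroup0.
have Kprod : gsub_set K ((r + s') *: (m + k')).
  rewrite scalerDl (subgroupDr hKz) // scalerDr (subgroupDr hKz) //.
  exact: gsub_scale.
case: (hK _ _ (subgroupD hRe Rr Rs') (subgroupD hMg Mm Mk')) => //.
  by rewrite (subgroupDr hKz) //; left.
by move=> rs'K; right=> x; have := rs'K x; rewrite scalerDl (subgroupDr hKz).
Qed.
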